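(* Let $S_a$ be a convergent subdivision scheme on $\mathbb{Z}^s$ with dilation matrix $mI$, $|m|\ge2$, that generates linear polynomials, i.e. whose symbol $a(z)$ satisfies Condition $Z_2$: $a(\mathbf 1)=|m|^s$ and $(D^j a)(\varepsilon)=0$ for all $\varepsilon\in\Xi'$ and all $j\in\mathbb{N}_0^s$ with $|j|<2$. Then $S_a$ reproduces linear polynomials (i.e. reproduces polynomials of degree up to $1$) if its parameter values are given by $t_\alpha^{(r)}=t_0^{(r)}+\alpha/m^r$, $t_0^{(r)}=t_0^{(r-1)}-\tau/m^r$, $t_0^{(0)}=0$, with $$\tau=|m|^{-s}\bigl(D^{\epsilon_1}a(\mathbf 1),\dots,D^{\epsilon_s}a(\mathbf 1)\bigr),$$ where $\epsilon_i$ is the $i$-th standard unit vector, so that $D^{\epsilon_i}=\partial/\partial z_i$.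
   Context: Fix $s\ge 1$ and an integer $m$ with $|m|\ge 2$. A mask is a finitely supported sequence $a=\{a_\alpha\in\mathbb{R}:\alpha\in\mathbb{Z}^s\}$. Its symbol is the Laurent polynomial $a(z)=\sum_{\alpha\in\mathbb{Z}^s}a_\alpha z^\alpha$, $z\in(\mathbb{C}\setminus\{0\})^s$, where $z^\alpha=z_1^{\alpha_1}\cdots z_s^{\alpha_s}$. Let $\ell(\mathbb{Z}^s)$ be the space of all real sequences indexed by $\mathbb{Z}^s$. The subdivision operator is $(S_a d)_\alpha=\sum_{\beta\in\mathbb{Z}^s}a_{\alpha-m\beta}\,d_\beta$ for $d\in\ell(\mathbb{Z}^s)$. The subdivision scheme $S_a$ is the recursion $d^{(r+1)}=S_a d^{(r)}$, $r\ge 0$, $d^{(0)}\in\ell(\mathbb{Z}^s)$. Parameter values: for $\tau\in\mathbb{R}^s$, the parameter values are the points $t_\alpha^{(r)}=t_0^{(r)}+\alpha/m^r\in\mathbb{R}^s$ ($\alpha\in\mathbb{Z}^s$, $r\ge 0$), where $t_0^{(0)}=0$ and $t_0^{(r)}=t_0^{(r-1)}-\tau/m^r$ for $r\ge 1$. The datum $d_\alpha^{(r)}$ is attached to the point $t_\alpha^{(r)}$. Convergence: for initial data $d=d^{(0)}$ the scheme has limit function $g_d$ if there are continuous functions $F^{(r)}:\mathbb{R}^s\to\mathbb{R}$ with $F^{(r)}(t_\alpha^{(r)})=d_\alpha^{(r)}$ for all $\alpha\in\mathbb{Z}^s$, $r\ge 0$, which converge uniformly on compact sets to $g_d$ as $r\to\infty$.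 One writes $S_a^\infty d=g_d$. The scheme is convergent if a limit function exists for every $d\in\ell(\mathbb{Z}^s)$. Reproduction: let $\Pi_k$ be the space of real polynomials on $\mathbb{R}^s$ of total degree at most $k$. A convergent scheme with parameter values $\{t^{(r)}\}$ reproduces polynomials of degree up to $k$ if for every $\pi\in\Pi_k$ and initial data $p^{(0)}_\alpha=\pi(t^{(0)}_\alpha)$, $\alpha\in\mathbb{Z}^s$, one has $S_a^\infty p^{(0)}=\pi$. Further notation: $D^j$, $j\in\mathbb{N}_0^s$, is the partial derivative of multi-order $j$, and $|j|=j_1+\dots+j_s$. Put $\mathbf 1=(1,\dots,1)$, $E=\{0,\dots,|m|-1\}^s$, $\Xi=\{(e^{-2\pi i e_1/m},\dots,e^{-2\pi i e_s/m}): (e_1,\dots,e_s)\in E\}$ and $\Xi'=\Xi\setminus\{\mathbf 1\}$. *)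

(* Defs.v *)
From HB Require Import structures.
From mathcomp Require Import all_boot all_order all_algebra finmap.
From mathcomp Require Import all_classical all_reals all_analysis.
From mathcomp Require Import complex.
(* The notations of [mpoly] clash with those of mathcomp-analysis. *)
From mathcomp Require mpoly.
Import -(notations) mpoly.
Set Implicit Arguments.
Unset Strict Implicit.
Unset Printing Implicit Defensive.
Import Order.TTheory GRing.Theory Num.Theory.
Import numFieldNormedType.Exports.
Local Open Scope classical_set_scope.
Local Open Scope ring_scope.

Definition scheme_mask (R : realType) (s : nat) := {fsfun 'rV[int]_s -> R with 0}.

Section Symbol.
Variables (R : realType) (s : nat).
Local Notation C := (R[i]).
Implicit Types (a : scheme_mask R s) (f : 'rV[C]_s -> C) (j : 'I_s -> nat).

(* Meaningful on [(C \ {0})^s] only, since [0 ^ n = 0] for [n < 0]. *)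
Definition symbol a (z : 'rV[C]_s) : C :=
  \sum_(alpha <- finsupp a) (a alpha)%:C%C * \prod_i z 0 i ^ alpha 0 i.

(* [derive] over the field [C] is the complex derivative. *)
Definition partial (i : 'I_s) f : 'rV[C]_s -> C :=
  fun z => 'D_(delta_mx 0 i : 'rV[C]_s) (f : 'rV[C]_s -> C^o) z.

(* The partial derivatives are composed in the order of the coordinates. *)
Definition Dmulti j f : 'rV[C]_s -> C :=
  foldr (fun i g => iter (j i) (partial i) g) f (enum 'I_s).

Definition unit_index (i : 'I_s) : 'I_s -> nat := fun k => (k == i) : nat.

(* [expi theta] is [e^(i theta)]. *)
Definition expi (theta : R) : C := Complex (cos theta) (sin theta).

Definition Xi (m : int) : set 'rV[C]_s :=
  [set \row_i expi (- (2 * pi * (e i)%:R / m%:~R)) | e in [set: 'I_s -> 'I_`|m|%N]].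

Definition Xi' (m : int) : set 'rV[C]_s := Xi m `\ const_mx 1.

Definition condition_Z (k : nat) (m : int) a : Prop :=
  symbol a (const_mx 1) = `|m|%:~R ^+ s /\
  forall eps, Xi' m eps ->
  forall j, (\sum_i j i < k)%N -> Dmulti j (symbol a) eps = 0.

End Symbol.

Section Scheme.
Variables (R : realType) (s : nat).
Implicit Types (m : int) (a : scheme_mask R s) (tau : 'rV[R]_s) (d : 'rV[int]_s -> R).

(* For [m != 0] at most finitely many terms are nonzero, so that the finitely
   supported sum over all [beta] is the intended one. *)
Definition subdivision m a d : 'rV[int]_s -> R :=
  fun alpha => \sum_(beta \in [set: 'rV[int]_s]) a (alpha - m *: beta) * d beta.

Definition data m a d (r : nat) : 'rV[int]_s -> R := iter r (subdivision m a) d.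

Fixpoint param0 m tau (r : nat) : 'rV[R]_s :=
  if r is r'.+1 then param0 m tau r' - (m%:~R ^+ r)^-1 *: tau else 0.

Definition param m tau (r : nat) (alpha : 'rV[int]_s) : 'rV[R]_s :=
  param0 m tau r + (m%:~R ^+ r)^-1 *: map_mx intr alpha.

(* The parameter values depend on [tau], hence so does convergence. *)
Definition is_limit_function m a tau d (g : 'rV[R]_s -> R) : Prop :=
  exists F : nat -> 'rV[R]_s -> R,
    [/\ forall r, continuous (F r),
        forall r alpha, F r (param m tau r alpha) = data m a d r alpha
      & {family compact, F @ \oo --> g}].

Definition convergent m a tau : Prop :=
  forall d, exists g, is_limit_function m a tau d g.

Definition polyfun (p : mpoly.mpoly s R) (x : 'rV[R]_s) : R :=
  mpoly.meval (fun i => x 0 i) p.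

(* [msize p] is one more than the total degree of [p], and [0] if [p = 0]. *)
Definition reproduces m a tau (k : nat) : Prop :=
  forall p : mpoly.mpoly s R, (mpoly.msize p <= k.+1)%N ->
  is_limit_function m a tau (fun alpha => polyfun p (param m tau 0 alpha))
    (polyfun p).

End Scheme.

(* Main.v *)
Require Import Defs.
From HB Require Import structures.
From mathcomp Require Import all_boot all_order all_algebra finmap.
From mathcomp Require Import all_classical all_reals all_analysis.
From mathcomp Require Import complex.
From mathcomp Require mpoly.
Import -(notations) mpoly.
From mathcomp Require Import ring lra zify.
Set Implicit Arguments.
Unset Strict Implicit.
Unset Printing Implicit Defensive.
Import Order.TTheory GRing.Theory Num.Theory.
Import numFieldNormedType.Exports.
Local Open Scope classical_set_scope.
Local Open Scope ring_scope.

(** Linear data are carried exactly from one level to the next: if the data at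
    level [r] are the values of an affine function [f] at the points
    [t_al^(r)], then the data at level [r+1] are the values of the same [f] at
    the points [t_al^(r+1)].  Hence [F^(r) := f] interpolates all the data and
    converges to [f] trivially.

    The step needs only two sum rules, for each coset [al + m Z^s]:
      [sum a_g = 1]   and   [sum a_g g = tau]   over the [g] in that coset.
    Indeed [(S_a d)_al] only involves the [a_g] with [g] in the coset of [al],
    weighted by [d] at [(al - g) / m], and the point [t^(r)] of that index
    differs from [t_al^(r+1)] by [(tau - g) / m^(r+1)].  So the first rule
    transports constants, and with it the second one makes the average of
    those differences vanish (lemma [subdivision_affine]).

    The sum rules come from discrete Fourier analysis on [(Z / m Z)^s].  A sum
    of coefficients over one coset is an average, weighted by a character, of
    values of the Laurent polynomial at the points of [Xi] (lemma
    [coset_sum]); if it vanishes on [Xi'], only the value at [1] remains.  Applied to [a(z)] this turns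
    [a(1) = |m|^s] into the first rule.  Applied to [z_i D_i a(z)], whose
    coefficients are [a_g g_i] and which vanishes on [Xi'] because [D_i a]
    does, it turns the definition of [tau] into the second rule. *)

(** * Laurent polynomials and their complex derivatives *)

Definition laurent (K : unitRingType) (s : nat) (r : seq 'rV[int]_s)
    (c : 'rV[int]_s -> K) (z : 'rV[K]_s) : K :=
  \sum_(g <- r) c g * \prod_i z 0 i ^ g 0 i.

(** Covers the coordinate functions, and also the factors of a monomial that do
    not involve the coordinate along which one differentiates ([c = 0]). *)
Lemma is_derive_affine (K : numFieldType) (V : normedModType K) (f : V -> K)
    (x v : V) (c : K) :
  (forall h : K, f (h *: v + x) = f x + h * c) -> is_derive x v f c.
Proof.
move=> fE.
have fc : (fun h => h^-1 *: ((f \o shift x) (h *: v) - f x)) @ 0^' --> (c : K).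
  apply: cvg_near_cst; near=> h; rewrite /= fE addrC addKr /GRing.scale /=.
  rewrite mulKf//; near: h; exact: nbhs_dnbhs_neq.
by split; [apply/cvg_ex; exists c | apply/cvg_lim].
Unshelve. all: by end_near. Qed.

Lemma is_derive_exprz (K : numFieldType) (V : normedModType K) (f : V -> K)
    (x v : V) (df : K) (n : int) :
  f x != 0 -> is_derive x v f df ->
  is_derive x v (fun y => f y ^ n) (n%:~R * f x ^ (n - 1) * df).
Proof.
move=> fx0 fdf; case: n => n.
  have -> : (fun y => f y ^ Posz n) = f ^+ n by apply/funext => y; rewrite fctE.
  have -> : n%:~R * f x ^ (n%:Z - 1) * df = (n%:R * f x ^+ n.-1) *: df.
    rewrite /GRing.scale /=; congr (_ * _).
    case: n => [|n]; first by rewrite !mul0r.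
    by have -> : n.+1%:Z - 1 = n by lia.
  exact: is_deriveX.
have fn0 : (f ^+ n.+1) x != 0 by rewrite fctE expf_neq0.
(* Negative exponents: differentiate the inverse of a natural power. *)
have dX : is_derive x v (f ^+ n.+1) ((n.+1%:R * f x ^+ n) *: df).
  exact: is_deriveX.
have -> : (fun y => f y ^ Negz n) = (fun y => ((f ^+ n.+1) y)^-1).
  by apply/funext => y; rewrite fctE.
split; first by apply: derivableV => //; case: dX.
rewrite deriveV//.
rewrite derive_val /GRing.scale /= mulrA; congr (_ * _).
rewrite NegzE mulrA rmorphN /= !mulNr; congr (- _).
rewrite [_ * n.+1%:R]mulrC -mulrA; congr (_ * _).
have -> : - n.+1%:Z - 1 = n%:Z - (n.+1 * 2)%:Z by rewrite muln2 -addnn; lia.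
by rewrite expfzDr// -invr_expz fctE -exprM mulrC.
Qed.

Section Laurent.
Variables (K : numFieldType) (s : nat).
Implicit Types (g : 'rV[int]_s) (z : 'rV[K]_s).

Lemma is_derive_monomial g z (i : 'I_s) :
  (forall k, z 0 k != 0) ->
  is_derive z (delta_mx 0 i : 'rV[K]_s) (fun z => \prod_k z 0 k ^ g 0 k : K)
     ((z 0 i)^-1 * ((g 0 i)%:~R * \prod_k z 0 k ^ g 0 k)).
Proof.
move=> z0.
have -> : (fun z : 'rV[K]_s => \prod_k z 0 k ^ g 0 k : K) =
  (fun z => z 0 i ^ g 0 i) * (fun z => \prod_(k | k != i) z 0 k ^ g 0 k).
  by apply/funext => y; rewrite fctE (bigD1 i).
have dc : is_derive z (delta_mx 0 i : 'rV[K]_s) (fun z => z 0 i : K) 1.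
  by apply: is_derive_affine => h; rewrite !mxE !eqxx /= addrC.
have dr : is_derive z (delta_mx 0 i : 'rV[K]_s)
    (fun z => \prod_(k | k != i) z 0 k ^ g 0 k : K) 0.
  apply: is_derive_affine => h; rewrite mulr0 addr0; apply: eq_bigr => k ki.
  by rewrite !mxE (negbTE ki) andbF mulr0 add0r.
have de := is_derive_exprz (g 0 i) (z0 i) dc.
apply: (is_derive_eq (is_deriveM de dr)).
rewrite scaler0 add0r /GRing.scale /= [in RHS](bigD1 i)//= expfzDr// exprN1.
ring.
Qed.

(** Stated through the Euler operator [z_i D_i], which multiplies the
    coefficient of [z^g] by [g_i] and leaves the exponents alone: the right-hand side is
    then again a Laurent polynomial with the same support. *)
Lemma derive_laurent r c z (i : 'I_s) :
  (forall k, z 0 k != 0) ->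
  'D_(delta_mx 0 i : 'rV[K]_s) (laurent r c) z
    = (z 0 i)^-1 * laurent r (fun g => c g * (g 0 i)%:~R) z.
Proof.
move=> z0.
have d j := @is_derive_monomial r`_j z i z0.
have -> : laurent r c = \sum_(j < size r)
    (c r`_j \*: (fun z : 'rV[K]_s => \prod_k z 0 k ^ r`_j 0 k : K)).
  apply/funext => y; rewrite /laurent (big_nth 0) big_mkord.
  by rewrite fct_sumE.
rewrite derive_sum => [|j]; last by have dj := d j; exact: derivableZ.
rewrite /laurent (big_nth 0) big_mkord mulr_sumr; apply: eq_bigr => j _.
have dj := d j; rewrite deriveZ// derive_val /GRing.scale /=.
ring.
Qed.

End Laurent.

Section Symbol.
Variables (R : realType) (s : nat).
Local Notation C := R[i].

Lemma symbolE (a : scheme_mask R s) :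
  symbol a = laurent (finsupp a) (fun g => (a g)%:C%C).
Proof. by []. Qed.

Lemma partial_symbol (a : scheme_mask R s) (z : 'rV[C]_s) (i : 'I_s) :
  (forall k, z 0 k != 0) ->
  partial i (symbol a) z =
    (z 0 i)^-1 * laurent (finsupp a) (fun g => (a g)%:C%C * (g 0 i)%:~R) z.
Proof. exact: derive_laurent. Qed.

Lemma Dmulti0 (f : 'rV[C]_s -> C) : Dmulti (fun=> 0%N) f = f.
Proof. by rewrite /Dmulti; elim: (enum _). Qed.

Lemma Dmulti_unit (i : 'I_s) (f : 'rV[C]_s -> C) :
  Dmulti (unit_index i) f = partial i f.
Proof.
rewrite /Dmulti /unit_index.
suff H r : uniq r -> foldr (fun k : 'I_s => iter (k == i) (partial k)) f r =
    if i \in r then partial i f else f.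
  by rewrite H ?enum_uniq// mem_enum.
elim: r => [_|k r IH /andP[kr ur]]; first by rewrite in_nil.
rewrite [LHS]/= (IH ur) in_cons; have [ki|ki] := eqVneq i k.
  by move: kr; rewrite -ki => /negbTE ->.
by [].
Qed.

End Symbol.

(** * Extracting a coset by a discrete Fourier transform *)

Definition same_coset (s M : nat) (al g : 'rV[int]_s) : bool :=
  [forall i, (M%:Z %| (g 0 i - al 0 i)%R)%Z].

Section CosetSums.
Variables (K : fieldType) (s M : nat) (w : K).
Hypothesis prim_w : M.-primitive_root w.

Lemma prim_root_neq0 : w != 0.
Proof.
apply/eqP => w0; have := prim_expr_order prim_w.
move/eqP; rewrite w0 expr0n gtn_eqF ?(prim_order_gt0 prim_w)//.
by rewrite eq_sym oner_eq0.
Qed.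

Lemma prim_expz_eq1 (n : int) : (w ^ n == 1) = (M%:Z %| n)%Z.
Proof.
have M0 : (M%:Z != 0) by have := prim_order_gt0 prim_w; lia.
rewrite (divz_eq n M) rpredDl ?dvdz_mull//.
rewrite expfzDr ?prim_root_neq0// mulrC [(_ %/ _)%Z * _]mulrC -exprz_exp.
rewrite -[w ^ M%:Z]/(w ^+ M) (prim_expr_order prim_w) exp1rz mulr1.
have := modz_ge0 n M0; case: (n %% M)%Z => // k _.
by rewrite dvdzE /= (prim_order_dvd prim_w).
Qed.

Lemma sum_prim_exprz (n : int) :
  \sum_(k < M) (w ^ n) ^+ k = if (M%:Z %| n)%Z then M%:R else 0.
Proof.
rewrite -prim_expz_eq1; case: eqVneq => [->|w1].
  by under eq_bigr do rewrite expr1n; rewrite sumr_const card_ord.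
have : (w ^ n) ^+ M - 1 = 0.
  rewrite -[_ ^+ M]/((w ^ n) ^ M%:Z) exprzAC -[w ^ M%:Z]/(w ^+ M).
  by rewrite (prim_expr_order prim_w) exp1rz subrr.
by rewrite subrX1 => /eqP; rewrite mulf_eq0 subr_eq0 (negbTE w1) => /eqP.
Qed.

(** Orthogonality of characters on [(Z / M Z)^s]: the sum over the characters
    factors into a product of geometric sums. *)
Lemma coset_filter (al g : 'rV[int]_s) :
  \sum_(e : {ffun 'I_s -> 'I_M}) \prod_i (w ^+ e i) ^ (g 0 i - al 0 i) =
  if same_coset M al g then M%:R ^+ s else 0.
Proof.
have powC (k : 'I_M) (n : int) : (w ^+ k) ^ n = (w ^ n) ^+ k.
  by rewrite -[w ^+ k]/(w ^ k%:Z) exprzAC.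
under eq_bigr => e _ do under eq_bigr => i _ do rewrite powC.
rewrite -(bigA_distr_bigA
  (fun (i : 'I_s) (k : 'I_M) => (w ^ (g 0%R i - al 0%R i)) ^+ k)).
under eq_bigr => i _ do rewrite sum_prim_exprz.
rewrite /same_coset; case: forallP => [H|/forallP].
  under eq_bigr => i _ do rewrite H.
  by rewrite prodr_const card_ord.
rewrite negb_forall => /existsP[i Hi].
by rewrite (bigD1 i)//= (negbTE Hi) mul0r.
Qed.

(** Multiplying the value at [w^e] by [w^(- e al)] and summing over [e] kills
    every coefficient outside the coset of [al], so a coset sum can be read off
    the values of the Laurent polynomial at the points [w^e].  When these vanish
    except at [1], the result no longer depends on the coset. *)
Lemma coset_sum (r : seq 'rV[int]_s) (c : 'rV[int]_s -> K) (al : 'rV[int]_s) :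
  (forall e : 'I_s -> 'I_M, \row_i w ^+ e i != const_mx 1 ->
     laurent r c (\row_i w ^+ e i) = 0) ->
  M%:R ^+ s * (\sum_(g <- r | same_coset M al g) c g) =
  laurent r c (const_mx 1).
Proof.
move=> c0.
have w0 (e : 'I_M) : w ^+ e != 0 by rewrite expf_neq0 ?prim_root_neq0.
have M0 := prim_order_gt0 prim_w.
transitivity (\sum_(e : {ffun 'I_s -> 'I_M})
    (\prod_i (w ^+ e i) ^ (- al 0 i)) * laurent r c (\row_i w ^+ e i)).
  under [RHS]eq_bigr => e _ do rewrite /laurent mulr_sumr.
  rewrite exchange_big mulr_sumr [LHS]big_mkcond; apply: eq_bigr => g _ /=.
  under eq_bigr => e _.
    rewrite mulrCA -big_split /=.
    under eq_bigr => i _ do rewrite mxE -expfzDr// addrC.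
    over.
  by rewrite -mulr_sumr coset_filter; case: ifP => _; rewrite ?mulr0// mulrC.
rewrite (bigD1 [ffun=> Ordinal M0])//= [X in _ + X]big1 => [|e ene].
  have -> : \row_i w ^+ ([ffun=> Ordinal M0] : {ffun 'I_s -> 'I_M}) i =
            const_mx 1.
    by apply/rowP => i; rewrite !mxE ffunE.
  by rewrite addr0 big1 ?mul1r// => i _; rewrite ffunE exp1rz.
(* As [w] is primitive, [w^e = 1] only for [e = 0]. *)
rewrite c0 ?mulr0//; apply: contra ene => /eqP/rowP e1.
apply/eqP/ffunP => i; apply/val_inj; rewrite ffunE /=; apply/eqP.
have := e1 i; rewrite !mxE => /eqP.
rewrite -(prim_order_dvd prim_w) /dvdn modn_small//.
Qed.

End CosetSums.

(** * The points of [Xi] as powers of a primitive root of unity *)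

Section RootsOfUnity.
Variable R : realType.

Lemma expiD (x y : R) : expi (x + y) = expi x * expi y.
Proof.
rewrite /expi cosD sinD; apply/eqP.
by rewrite eq_complex /= eqxx addrC eqxx.
Qed.

Lemma expiMn (x : R) (n : nat) : expi (x *+ n) = expi x ^+ n.
Proof.
elim: n => [|n IH]; first by rewrite mulr0n /expi cos0 sin0.
by rewrite mulrS exprS expiD IH.
Qed.

Lemma cos_neq1 (x : R) : 0 < x < pi *+ 2 -> cos x != 1.
Proof.
move=> /andP[x0 x2]; apply/eqP => c1.
have s0 : 0 < sin (x / 2) by apply: sin_gt0_pi; apply/andP; split; lra.
have := cos2Dsin2 (x / 2); have : x = (x / 2) *+ 2 by lra.
move=> xE; move: c1; rewrite {1}xE cos_mulr2n => c1.
have : 0 < sin (x / 2) ^+ 2 by rewrite exprn_gt0.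
lra.
Qed.

(** The sign of [m] only decides between a root and its conjugate; the real
    part, which tells whether a power equals [1], does not see it. *)
Lemma prim_root_expi (m : int) : m != 0 ->
  `|m|%N.-primitive_root (expi (- (2 * pi / m%:~R)) : R[i]).
Proof.
move=> m0; have M0 : (0 < `|m|)%N by rewrite absz_gt0.
have mM : `|m%:~R| = `|m|%N%:R :> R by rewrite -intr_norm -abszE.
have MR : 0 < (`|m|%N%:R : R) by rewrite ltr0n.
have cosE (k : nat) :
    cos (- (2 * pi / m%:~R) *+ k : R) = cos (2 * pi * k%:R / `|m|%N%:R).
  rewrite mulNrn cosN -mM; have [h|h] := ger0P (m%:~R : R).
    by congr cos; rewrite -[_ *+ k]mulr_natr mulrAC.
  by rewrite -cosN; congr cos; rewrite -[_ *+ k]mulr_natr invrN mulrN mulrAC.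
apply/andP; split => //; apply/forallP => k; apply/eqP.
rewrite unity_rootE -expiMn; have [kM|kM] := eqVneq k.+1 `|m|%N.
  have c1 : cos (- (2 * pi / m%:~R) *+ k.+1 : R) = 1.
    by rewrite cosE kM mulfK ?gt_eqF// mulr_natl cos2pi.
  apply/eqP; rewrite /expi c1; congr Complex.
  by apply/eqP; rewrite -norm_cos_eq1 c1 normr1.
apply/negbTE; rewrite eq_complex negb_and /= cosE cos_neq1//.
have kM1 : (k.+1 < `|m|)%N by rewrite ltn_neqAle kM ltn_ord.
have := pi_gt0 R; move: kM1; rewrite -(ltr_nat R) => kM1 pi0.
apply/andP; split; first by rewrite divr_gt0// ?mulr_gt0// ltr0n.
by rewrite ltr_pdivrMr// -[pi *+ 2]mulr_natl ltr_pM2l// mulr_gt0.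
Qed.

End RootsOfUnity.

(** * Sum rules and the transport of linear data *)

Section SumRules.
Variables (R : realType) (s : nat) (m : int) (a : scheme_mask R s).
Hypothesis m0 : m != 0.
Local Notation C := R[i].
Local Notation M := `|m|%N.

Lemma mem_Xi' (e : 'I_s -> 'I_M) :
  let z := \row_i (expi (- (2 * pi / m%:~R)) : C) ^+ e i in
  z != const_mx 1 -> Xi' m z.
Proof.
move=> z z1; split; last by move=> /= zE; rewrite zE eqxx in z1.
exists e => //; apply/rowP => i; rewrite !mxE -expiMn; congr expi.
by rewrite mulr_natr mulNrn mulrnAl.
Qed.

Lemma Xi'_neq0 (z : 'rV[C]_s) : Xi' m z -> forall k, z 0 k != 0.
Proof.
move=> [[e _ <-] _] k; rewrite mxE; apply/eqP => /eqP.
rewrite eq_complex /= => /andP[/eqP c0 /eqP s0].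
have := cos2Dsin2 (- (2 * pi * (e k)%:R / m%:~R) : R).
by rewrite c0 s0 expr0n addr0 => /eqP; rewrite eq_sym oner_eq0.
Qed.

Lemma coset_sumR (b : 'rV[int]_s -> R) (al : 'rV[int]_s) :
  (forall z, Xi' m z -> laurent (finsupp a) (fun g => (b g)%:C%C) z = 0) ->
  (\sum_(g <- finsupp a | same_coset M al g) b g)%:C%C =
  (M%:R ^+ s)^-1 * laurent (finsupp a) (fun g => (b g)%:C%C) (const_mx 1).
Proof.
move=> b0.
rewrite -(coset_sum (prim_root_expi R m0) al); last first.
  by move=> e /mem_Xi'; exact: b0.
by rewrite mulKf ?rmorph_sum// expf_neq0// pnatr_eq0 absz_eq0.
Qed.

Hypothesis Z2 : condition_Z 2 m a.
Variable tau : 'rV[R]_s.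
Hypothesis tauE : forall i : 'I_s, (tau 0 i)%:C%C =
     (`|m|%:~R ^+ s)^-1 * Dmulti (unit_index i) (symbol a) (const_mx 1).

Lemma sum_rule0 (al : 'rV[int]_s) :
  \sum_(g <- finsupp a | same_coset M al g) a g = 1.
Proof.
case: Z2 => a1 a0; apply: (@complexI R); rewrite coset_sumR => [|z Xz].
  rewrite -symbolE a1 -abszE mulVf// expf_neq0// pnatr_eq0 absz_eq0//.
by rewrite -symbolE -[symbol a]Dmulti0 a0// big1.
Qed.

Lemma sum_rule1 (al : 'rV[int]_s) (i : 'I_s) :
  \sum_(g <- finsupp a | same_coset M al g) a g * (g 0 i)%:~R = tau 0 i.
Proof.
case: Z2 => a1 a0; apply: (@complexI R).
have lE z : laurent (finsupp a) (fun g => (a g * (g 0 i)%:~R)%:C%C) z =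
    laurent (finsupp a) (fun g => (a g)%:C%C * (g 0 i)%:~R) z.
  by apply: eq_bigr => g _; rewrite rmorphM rmorph_int.
rewrite coset_sumR => [|z Xz].
  rewrite lE tauE Dmulti_unit partial_symbol => [|k]; last first.
    by rewrite mxE oner_eq0.
  by rewrite mxE invr1 mul1r -abszE.
have z0 := Xi'_neq0 Xz.
have i2 : (\sum_k unit_index i k < 2)%N.
  by rewrite /unit_index (bigD1 i)//= eqxx big1// => k /negbTE ->.
have := a0 z Xz _ i2; rewrite Dmulti_unit partial_symbol// -lE => /eqP.
by rewrite mulf_eq0 invr_eq0 (negbTE (z0 i)) => /eqP.
Qed.

(** The index [beta] contributes the coefficient at [g = al - m beta], so the
    sum over [beta] is one over the part of the support in the coset of [al]. *)
Lemma subdivisionE (d : 'rV[int]_s -> R) (al : 'rV[int]_s) :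
  subdivision m a d al =
  \sum_(g <- finsupp a | same_coset M al g)
     a g * d (\row_i ((al 0 i - g 0 i)%R %/ m)%Z).
Proof.
pose q (g : 'rV[int]_s) : 'rV[int]_s := \row_i ((al 0 i - g 0 i)%R %/ m)%Z.
pose h (be : 'rV[int]_s) : 'rV[int]_s := al - m *: be.
have qh be : q (h be) = be.
  by apply/rowP => i; rewrite !mxE opprB addrC subrK mulKz.
have hq g : same_coset M al g -> h (q g) = g.
  move=> /forallP H; apply/rowP => i; rewrite !mxE mulrC divzK ?subKr//.
  by have := H i; rewrite -opprB !dvdzE abszN.
have qP be : same_coset M al (h be).
  apply/forallP => i; rewrite !mxE addrAC subrr add0r dvdzE abszN abszM.
  exact: dvdn_mulr.
rewrite /subdivision.
transitivity (\sum_(g \in h @` [set: 'rV[int]_s]) a g * d (q g)).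
  rewrite (@fsbig_image _ _ _ _ _ setT h) => [|x y _ _ /(congr1 q)]; last first.
    by rewrite !qh.
  by apply: eq_fsbigr => be _; rewrite qh.
rewrite (fsbigE [seq g <- finsupp a | same_coset M al g]).
- rewrite big_filter_cond; apply: eq_bigl => g.
  apply: andb_idr => Hg; rewrite inE; exists (q g) => //; exact: hq.
- by rewrite filter_uniq// fset_uniq.
- move=> g /=; rewrite mem_filter => /andP[Hg _]; exists (q g) => //; exact: hq.
- move=> g [be _ <-]; rewrite mem_filter qP /= => ha.
  by rewrite fsfun_dflt// mul0r.
Qed.

(** The shift of the parameter values by [tau] at each level compensates for
    the centre of mass of the mask on each coset, which is [tau] by
    [sum_rule1]. *)
Lemma subdivision_affine (c : R) (b : 'rV[R]_s) (r : nat) :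
  let f (x : 'rV[R]_s) := c + \sum_i b 0 i * x 0 i in
  subdivision m a (fun al => f (param m tau r al)) =
  fun al => f (param m tau r.+1 al).
Proof.
move=> f; apply/funext => al; rewrite subdivisionE.
have mR : (m%:~R : R) != 0 by rewrite intr_eq0.
pose u : R := (m%:~R ^+ r.+1)^-1.
have fE g : same_coset M al g ->
    f (param m tau r (\row_i ((al 0 i - g 0 i)%R %/ m)%Z)) =
    f (param m tau r.+1 al) + \sum_i b 0 i * (u * (tau 0 i - (g 0 i)%:~R)).
  move=> /forallP H; rewrite /f -addrA -big_split /=; congr (_ + _).
  apply: eq_bigr => i _; rewrite -mulrDr; congr (_ * _).
  rewrite !mxE -/u.
  have -> : (m%:~R ^+ r)^-1 = u * m%:~R :> R.
    by rewrite /u exprS invfM mulrAC mulVf ?mul1r.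
  rewrite -mulrA -intrM [(m * _)%R]mulrC divzK; last first.
    by have := H i; rewrite -opprB !dvdzE abszN.
  rewrite intrB; ring.
under eq_bigr => g Hg do rewrite (fE _ Hg) mulrDr.
rewrite big_split /= -mulr_suml sum_rule0 mul1r.
rewrite [X in _ + X](_ : _ = 0) ?addr0//.
under eq_bigr => g _ do rewrite mulr_sumr.
rewrite exchange_big /= big1// => i _.
transitivity (b 0 i * u *
    (tau 0 i * (\sum_(g <- finsupp a | same_coset M al g) a g) -
     \sum_(g <- finsupp a | same_coset M al g) a g * (g 0 i)%:~R)).
  rewrite mulr_sumr -sumrB mulr_sumr; apply: eq_bigr => g _; ring.
by rewrite sum_rule0 sum_rule1 mulr1 subrr mulr0.
Qed.

End SumRules.

(** A multi-index of degree less than [2] is zero or a unit vector. *)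
Lemma polyfun_affine (R : realType) (s : nat) (p : mpoly.mpoly s R) :
  (mpoly.msize p <= 2)%N ->
  exists c (b : 'rV[R]_s), polyfun p = fun x => c + \sum_i b 0 i * x 0 i.
Proof.
move=> p2; suff H (r : seq (mpoly.multinom s)) (k : mpoly.multinom s -> R) :
    all (fun m => mpoly.mdeg m < 2)%N r ->
    exists c (b : 'rV[R]_s), forall x : 'rV[R]_s,
      \sum_(m <- r) k m * \prod_i x 0 i ^+ mpoly.fun_of_multinom m i
      = c + \sum_i b 0 i * x 0 i.
  have [|c [b Hb]] := H (mpoly.msupp p) (fun m => mpoly.mcoeff m p).
    by apply/allP => m mp; apply: leq_trans (mpoly.msize_mdeg_lt mp) p2.
  by exists c, b; apply/funext => x; rewrite /polyfun mpoly.mevalE.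
elim: r => [_|m r IH /= /andP[m2 /IH[c [b Hb]]]].
  exists 0, 0 => x; rewrite big_nil add0r big1// => i _; by rewrite mxE mul0r.
move: m2; rewrite ltnS leq_eqVlt ltnS leqn0 mpoly.mdeg_eq0 mpoly.mdeg_eq1.
case/orP => [/existsP[j /eqP mj]|/eqP m0].
  exists c, (b + k m *: delta_mx 0 j) => x; rewrite big_cons Hb mj.
  have -> : \prod_i x 0 i ^+ mpoly.fun_of_multinom (mpoly.mnm1 j) i = x 0 j.
    rewrite (bigD1 j)//= mpoly.mnm1E eqxx expr1 big1 ?mulr1// => i /negbTE ij.
    by rewrite mpoly.mnm1E eq_sym ij expr0.
  under [in RHS]eq_bigr do rewrite !mxE eqxx /= mulrDl.
  rewrite big_split /=.
  have -> : \sum_i k (mpoly.mnm1 j) * (i == j)%:R * x 0 i =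
            k (mpoly.mnm1 j) * x 0 j.
    rewrite (bigD1 j)//= eqxx mulr1 big1 ?addr0// => i /negbTE ->.
    by rewrite mulr0 mul0r.
  by rewrite addrCA [X in _ + X]addrC addrA.
exists (k m + c), b => x; rewrite big_cons Hb m0 big1 ?mulr1 ?addrA// => i _.
by rewrite mpoly.mnm0E expr0.
Qed.

Lemma continuous_affine (R : realType) (s : nat) (c : R) (b : 'rV[R]_s) :
  continuous (fun x : 'rV[R]_s => c + \sum_i b 0 i * x 0 i).
Proof.
pose g (r : seq 'I_s) (y : 'rV[R]_s) := \sum_(i <- r) b 0 i * y 0 i.
suff cg r : continuous (g r).
  move=> x; apply: (@continuousD _ _ _ (fun=> c)); first exact: cst_continuous.
  exact: cg.
elim: r => [|i r IH].
  have -> : g [::] = fun=> 0 by apply/funext => y; rewrite /g big_nil.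
  exact: cst_continuous.
have -> : g (i :: r) = (fun y : 'rV[R]_s => b 0 i * y 0 i) + g r.
  by apply/funext => y; rewrite /g big_cons.
move=> x; apply: continuousD; last exact: IH.
apply: (@continuousM _ _ (fun=> b 0 i)); first exact: cst_continuous.
exact: coord_continuous.
Qed.

Theorem corollary2p4 (R : realType) (s : nat) (m : int) (a : scheme_mask R s)
    (tau : 'rV[R]_s) :
  (1 <= s)%N -> 2 <= `|m| ->
  condition_Z 2 m a ->
  (forall i : 'I_s, (tau 0 i)%:C%C =
     (`|m|%:~R ^+ s)^-1 * Dmulti (unit_index i) (symbol a) (const_mx 1)) ->
  convergent m a tau ->
  reproduces m a tau 1.
Proof.
move=> _ m2 Z2 tauE _ p /polyfun_affine[c [b pE]].
have m0 : m != 0 by apply/eqP => m0; rewrite m0 normr0 in m2.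
exists (fun=> polyfun p); split.
- by move=> _; rewrite pE; exact: continuous_affine.
- move=> r al; rewrite /data pE.
  pose f (x : 'rV[R]_s) := c + \sum_i b 0 i * x 0 i.
  suff -> : iter r (subdivision m a) (fun al => f (param m tau 0 al)) =
            fun al => f (param m tau r al) by [].
  elim: r => // r IH; rewrite iterS IH.
  exact: subdivision_affine.
- exact: (@cvg_cst {family compact, 'rV[R]_s -> R} (polyfun p)).
Qed.
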